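(* Let $m$ be a positive integer and consider link diagrams $L_0, L_-, L_\infty$ and $L_m$ which are identical except within a ball (disk), where they are respectively the tangles $[0]$, $\overline{X}$, $[\infty]$, and a horizontal row of $m$ crossings each equal to $X$. Then $$P(L_m)=A_mP(L_-)+B_mP(L_0)-C_mP(L_\infty),$$ where $$A_m=B_{m-1}\ \text{ for } m>1,\qquad A_1=1,$$ $$B_m=\sum_{i=0}^{\lfloor m/2\rfloor}z^{m-2i}\binom{m-i}{i},$$ $$C_m=\sum_{j=1}^{m}\ \sum_{i=0}^{\lfloor (j-1)/2\rfloor}z^{j-2i}a^{j-m}\binom{j-1-i}{i}.$$
   Context: All links are unoriented and given by planar diagrams. Inside a disk with four boundary points NW, NE, SW, SE consider four tangles: the crossing $X$, in which the strand joining NW to SE passes over the strand joining SW to NE; the switched crossing $\overline{X}$, in which the strand joining SW to NE passes over the strand joining NW to SE; the tangle $[0]$, consisting of two crossingless arcs NW--NE and SW--SE; and the tangle $[\infty]$, consisting of two crossingless arcs NW--SW and NE--SE. A horizontal row of $m$ crossings $X$ is the tangle obtained by placing $m$ copies of $X$ side by side from left to right, joining the NE and SE endpoints of each copy to the NW and SW endpoints, respectively, of the next one (so it consists of $m$ half-twists). Dubrovnik polynomial: $P(K)=P(K)(z,a)\in\mathbb{Z}[a^{\pm1},z^{\pm1}]$ is the unique function of unoriented link diagrams $K$ such that (1) $P$ is invariant under regular isotopy (planar isotopy and Reidemeister moves II and III); (2) $P(K_X)-P(K_{\overline{X}})=z\,[P(K_{[0]})-P(K_{[\infty]})]$ whenever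 the four diagrams are identical outside a disk in which they are the indicated tangles; (3) $P(\text{diagram with positive curl})=a\,P(\text{diagram with the curl removed})$ and $P(\text{diagram with negative curl})=a^{-1}P(\text{diagram with the curl removed})$, where a curl is a Reidemeister I kink, and it is positive or negative according to the sign of its crossing (which does not depend on the orientation); (4) $P$ of the crossingless diagram of the unknot is $1$. *)

(* Defs.v *)
From HB Require Import structures.
From Stdlib Require Import Relation_Operators.
From mathcomp Require Import all_boot all_order all_algebra.
From mathcomp Require Import zify.

Set Implicit Arguments.
Unset Strict Implicit.
Unset Printing Implicit Defensive.

Import GRing.Theory.

(** Planar tangle diagrams are taken in Morse position with respect to the
    horizontal coordinate and read from left to right.  A generic vertical line
    meets the diagram in finitely many points, numbered 0, 1, 2, ... from top
    to bottom, and the diagram is a sequence of slices, each of which contains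
    one birth of two strands, one merging of two strands, or one crossing.
    Every planar diagram can be put in this form by a planar isotopy. *)

(** [Cup] is an arc open to the right, creating two adjacent strands; [Cap] is
    an arc open to the left, joining two adjacent strands.  In [Cross true] the
    NW--SE strand is over, in [Cross false] the SW--NE strand is over. *)
Inductive gen : Type := Cup | Cap | Cross of bool.

Definition gin (g : gen) : nat := if g is Cup then 0 else 2.
Definition gout (g : gen) : nat := if g is Cap then 0 else 2.

(** [(g, i)] is the slice in which [g] has exactly [i] strands above it. *)
Definition slice : Type := (gen * nat)%type.

(** Number of strands at the right end of a word starting with [n] strands, or
    [None] if some slice does not fit. *)
Fixpoint run (n : nat) (w : seq slice) : option nat :=
  if w is (g, i) :: w' then
    if i + gin g <= n then run (n - gin g + gout g) w' else None
  else Some n.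

(** Tangle diagrams with [k] endpoints on the left and [l] on the right. *)
Record tangle (k l : nat) : Type :=
  Tangle { word :> seq slice; _ : run k word == Some l }.

HB.instance Definition _ (k l : nat) := [isSub for @word k l].

(** Unoriented link diagrams. *)
Definition diagram : Type := tangle 0 0.

Lemma comp_subproof k l n (S : tangle k l) (T : tangle l n) :
  run k (S ++ T) == Some n.
Proof.
case: S T => [S /= hS] [T /= hT].
elim: S k hS => [|[g i] S IH] k /=; first by case/eqP=> ->.
by case: ifP => // _; apply: IH.
Qed.

(** [comp S T] puts [S] to the left of [T]. *)
Definition comp k l n (S : tangle k l) (T : tangle l n) : tangle k n :=
  Tangle (comp_subproof S T).

Definition shift (p : nat) (w : seq slice) : seq slice :=
  [seq (s.1, p + s.2) | s <- w].

Lemma pad_subproof p q k l (T : tangle k l) :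
  run (p + k + q) (shift p T) == Some (p + l + q).
Proof.
case: T => [T /= hT].
elim: T k hT => [|[g i] T IH] k /=; first by case/eqP=> ->.
case: ifP => // hi hT.
have -> : p + i + gin g <= p + k + q by lia.
have -> : p + k + q - gin g + gout g = p + (k - gin g + gout g) + q by lia.
exact: IH.
Qed.

(** [pad p q T] is [T] with [p] horizontal strands above and [q] below. *)
Definition pad p q k l (T : tangle k l) : tangle (p + k + q) (p + l + q) :=
  Tangle (pad_subproof p q T).

(** The part of a link diagram outside a disk (a rectangle) whose boundary it
    meets in [k] points on the left side and [l] points on the right side. *)
Record exterior (k l : nat) : Type := Exterior {
  above : nat;
  below : nat;
  ext_left : tangle 0 (above + k + below);
  ext_right : tangle (above + l + below) 0 }.

Definition plug k l (E : exterior k l) (T : tangle k l) : diagram :=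
  comp (comp (ext_left E) (pad (above E) (below E) T)) (ext_right E).

(** The elementary moves relating two Morse presentations of isotopic planar
    diagrams: exchange of two slices whose supports are one above the other,
    straightening of an S-shaped strand, and passage of a turning point of a
    strand through a crossing.  In the last case the two strands exchange the
    roles of NW--SE branch and SW--NE branch of the crossing, so the same
    over/under information is recorded by opposite booleans on the two sides. *)
Inductive planar_move : seq slice -> seq slice -> Prop :=
| pm_exchange g h i j : i + gout g <= j ->
    planar_move [:: (g, i); (h, j)] [:: (h, j - gout g + gin g); (g, i)]
| pm_zigzag_down i : planar_move [:: (Cup, i); (Cap, i.+1)] [::]
| pm_zigzag_up i : planar_move [:: (Cup, i.+1); (Cap, i)] [::]
| pm_cap_slide b i :
    planar_move [:: (Cross b, i); (Cap, i.+1)]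
                [:: (Cross (~~ b), i.+1); (Cap, i)]
| pm_cup_slide b i :
    planar_move [:: (Cup, i.+1); (Cross b, i)]
                [:: (Cup, i); (Cross (~~ b), i.+1)].

(** In the third Reidemeister move each crossing keeps its over/under
    information; the side condition excludes the two choices for which the
    three strands are cyclically over one another. *)
Inductive reidemeister_move : seq slice -> seq slice -> Prop :=
| rm_II b i :
    reidemeister_move [:: (Cross b, i); (Cross (~~ b), i)] [::]
| rm_III b1 b2 b3 i : (b2 == b1) || (b2 == b3) ->
    reidemeister_move [:: (Cross b1, i); (Cross b2, i.+1); (Cross b3, i)]
                      [:: (Cross b3, i.+1); (Cross b2, i); (Cross b1, i.+1)].

Definition applied (move : seq slice -> seq slice -> Prop) (D E : diagram) :
    Prop :=
  exists u v l r : seq slice,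
    [/\ move l r, word D = u ++ l ++ v & word E = u ++ r ++ v].

Definition planar_isotopic : diagram -> diagram -> Prop :=
  clos_refl_sym_trans diagram (applied planar_move).

Definition regular_isotopic : diagram -> diagram -> Prop :=
  clos_refl_sym_trans diagram
    (fun D E => applied planar_move D E \/ applied reidemeister_move D E).

(** [L] has the exterior [E] and is [T] inside the disk.  Because an arbitrary
    disk has to be moved to a rectangle with the prescribed boundary points,
    this is up to planar isotopy. *)
Definition fills k l (E : exterior k l) (T : tangle k l) (L : diagram) : Prop :=
  planar_isotopic L (plug E T).

Definition trivial_tangle k : tangle k k := @Tangle k k [::] (eqxx _).

Definition tangle_X : tangle 2 2 := @Tangle 2 2 [:: (Cross true, 0)] isT.
Definition tangle_Xbar : tangle 2 2 := @Tangle 2 2 [:: (Cross false, 0)] isT.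
Definition tangle_0 : tangle 2 2 := trivial_tangle 2.
Definition tangle_oo : tangle 2 2 :=
  @Tangle 2 2 [:: (Cap, 0); (Cup, 0)] isT.

Fixpoint row_X (m : nat) : tangle 2 2 :=
  if m is m'.+1 then comp (row_X m') tangle_X else tangle_0.

(** The Reidemeister I kinks on a strand running from left to right, with the
    loop below ([side = true]) or above ([side = false]) the strand.  Oriented
    from left to right, the strand passes twice through the crossing, both
    times from left to right; hence the crossing is positive exactly when its
    NW--SE branch is over, i.e. when [positive = true]. *)
Definition curl (side positive : bool) : tangle 1 1 :=
  if side
  then @Tangle 1 1 [:: (Cup, 1); (Cross positive, 0); (Cap, 1)] isT
  else @Tangle 1 1 [:: (Cup, 0); (Cross positive, 1); (Cap, 0)] isT.

Definition unknot : diagram := @Tangle 0 0 [:: (Cup, 0); (Cap, 0)] isT.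

Local Open Scope ring_scope.

(** The Laurent polynomial ring Z[a^{+-1}, z^{+-1}] is the subring [laurent] of
    the field of fractions of Z[a][z]. *)
Definition ratfun : fieldType := {fraction {poly {poly int}}}.
Definition avar : ratfun := tofrac ('X%:P : {poly {poly int}}).
Definition zvar : ratfun := tofrac ('X : {poly {poly int}}).

Definition laurent (x : ratfun) : Prop :=
  exists (p : {poly {poly int}}) (k : nat), x = tofrac p / (avar * zvar) ^+ k.

(** The axioms characterizing the Dubrovnik polynomial.  They leave the value
    at the empty diagram free, which never arises by filling an exterior. *)
Record dubrovnik (P : diagram -> ratfun) : Prop := Dubrovnik {
  dubrovnik_laurent : forall K : diagram, laurent (P K);
  dubrovnik_isotopy : forall K K' : diagram,
    regular_isotopic K K' -> P K = P K';
  dubrovnik_skein : forall (E : exterior 2 2) (KX KXbar K0 Koo : diagram),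
    fills E tangle_X KX -> fills E tangle_Xbar KXbar ->
    fills E tangle_0 K0 -> fills E tangle_oo Koo ->
    P KX - P KXbar = zvar * (P K0 - P Koo);
  dubrovnik_curl_pos : forall (E : exterior 1 1) (side : bool) (K K' : diagram),
    fills E (curl side true) K -> fills E (trivial_tangle 1) K' ->
    P K = avar * P K';
  dubrovnik_curl_neg : forall (E : exterior 1 1) (side : bool) (K K' : diagram),
    fills E (curl side false) K -> fills E (trivial_tangle 1) K' ->
    P K = avar^-1 * P K';
  dubrovnik_unknot : P unknot = 1 }.

Definition B_coef (m : nat) : ratfun :=
  \sum_(0 <= i < (m %/ 2).+1) zvar ^+ (m - 2 * i) * ('C(m - i, i))%:R.

Definition A_coef (m : nat) : ratfun :=
  if m == 1%N then 1 else B_coef (m - 1).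

Definition C_coef (m : nat) : ratfun :=
  \sum_(1 <= j < m.+1) \sum_(0 <= i < ((j - 1) %/ 2).+1)
    zvar ^+ (j - 2 * i) * avar ^ (j%:Z - m%:Z) * ('C(j - 1 - i, i))%:R.

(* Main.v *)
(** Write [p_m] for the value at the row of [m] crossings.  The skein relation
    at the last crossing of the row, together with a Reidemeister II move, gives
    [p_(m+2) - p_m = z (p_(m+1) - a^-(m+1) p_oo)]: in the [oo] smoothing the
    remaining [m+1] crossings are negative curls on the left arc of [oo].  The
    coefficients satisfy the same recurrence, since
    [B_(m+2) = z B_(m+1) + B_m] (Pascal's rule) and
    [C_(m+1) = a^-1 C_m + z B_m]. *)
From mathcomp Require Import all_boot all_order all_algebra.
From mathcomp Require Import zify ring.
From Stdlib Require Import Relation_Operators.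
Require Import Defs.

Set Implicit Arguments.
Unset Strict Implicit.
Unset Printing Implicit Defensive.

Import GRing.Theory.

Lemma planar_move_shift p l r :
  planar_move l r -> planar_move (shift p l) (shift p r).
Proof.
case=> [g h i j hij | i | i | b i | b i]; rewrite /shift /= ?addnS.
- have -> : p + (j - gout g + gin g) = p + j - gout g + gin g by lia.
  by apply: pm_exchange; lia.
- exact: pm_zigzag_down.
- exact: pm_zigzag_up.
- exact: pm_cap_slide.
- exact: pm_cup_slide.
Qed.

Lemma reidemeister_move_shift p l r :
  reidemeister_move l r -> reidemeister_move (shift p l) (shift p r).
Proof.
case=> [b i | b1 b2 b3 i hb]; rewrite /shift /= ?addnS.
- exact: rm_II.
- exact: rm_III.
Qed.

(** Treating a factor of the tangle as part of the exterior lets an axiom about one disk act on a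
    single factor of a composite. *)
Definition absorb_left k l n (E : exterior k l) (S : tangle k n) :
    exterior n l :=
  Exterior (comp (ext_left E) (pad (above E) (below E) S)) (ext_right E).

Definition absorb_right k l n (E : exterior k l) (T : tangle n l) :
    exterior k n :=
  Exterior (ext_left E) (comp (pad (above E) (below E) T) (ext_right E)).

Lemma plug_absorb_left k l n (E : exterior k l) (S : tangle k n)
    (T : tangle n l) :
  plug (absorb_left E S) T = plug E (comp S T).
Proof. by apply: val_inj; rewrite /= /shift map_cat !catA. Qed.

Lemma plug_absorb_right k l n (E : exterior k l) (S : tangle k n)
    (T : tangle n l) :
  plug (absorb_right E T) S = plug E (comp S T).
Proof. by apply: val_inj; rewrite /= /shift map_cat !catA. Qed.

Lemma widen_left_subproof p q k l (E : exterior (p + k + q) l) :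
  run 0 (ext_left E) == Some (above E + p + k + (q + below E)).
Proof.
case: E => a b [w hw] ? /=.
by have -> : a + p + k + (q + b) = a + (p + k + q) + b by lia.
Qed.

Lemma widen_right_subproof p q k l (E : exterior k (p + l + q)) :
  run (above E + p + l + (q + below E)) (ext_right E) == Some 0.
Proof.
case: E => a b ? [w hw] /=.
by have -> : a + p + l + (q + b) = a + (p + l + q) + b by lia.
Qed.

(** Shrinks the disk past the padding strands; the curl axioms need a disk crossed by one strand
    only. *)
Definition absorb_pad p q k l (E : exterior (p + k + q) (p + l + q)) :
    exterior k l :=
  Exterior (Tangle (widen_left_subproof E)) (Tangle (widen_right_subproof E)).

Lemma plug_absorb_pad p q k l (E : exterior (p + k + q) (p + l + q))
    (T : tangle k l) :
  plug (absorb_pad E) T = plug E (pad p q T).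
Proof.
apply: val_inj; rewrite /= /shift -map_comp; congr ((_ ++ _) ++ _).
by apply: eq_map => s /=; rewrite addnA.
Qed.

Lemma compA k l n o (S : tangle k l) (T : tangle l n) (U : tangle n o) :
  comp S (comp T U) = comp (comp S T) U.
Proof. by apply: val_inj; rewrite /= catA. Qed.

Local Open Scope ring_scope.

Section Dubrovnik.

Variables (P : diagram -> ratfun) (hP : dubrovnik P).

Lemma dubrovnik_fills k l (E : exterior k l) (T : tangle k l) (L : diagram) :
  fills E T L -> P L = P (plug E T).
Proof.
move=> h; apply: (dubrovnik_isotopy hP).
elim: h => [D D' hD | D | D D' _ | D D' D'' _ + _].
- by apply: rst_step; left.
- exact: rst_refl.
- exact: rst_sym.
- exact: rst_trans.
Qed.

(** Plugging only shifts the positions of slices, and a shifted move is again a move. *)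
Lemma dubrovnik_move k l (E : exterior k l) (S T : tangle k l)
    (x y : seq slice) (u v : seq slice) :
  planar_move x y \/ reidemeister_move x y ->
  word S = u ++ x ++ v -> word T = u ++ y ++ v ->
  P (plug E S) = P (plug E T).
Proof.
move=> hxy hS hT; apply: (dubrovnik_isotopy hP); apply: rst_step.
have word_plug (R : tangle k l) r : word R = u ++ r ++ v ->
    word (plug E R) = (ext_left E ++ shift (above E) u)
      ++ shift (above E) r ++ (shift (above E) v ++ ext_right E).
  by move=> hR; rewrite /= hR /shift !map_cat !catA.
case: hxy => hxy; [left | right]; do 4 eexists; split;
  try exact: word_plug hS; try exact: word_plug hT.
- exact: planar_move_shift hxy.
- exact: reidemeister_move_shift hxy.
Qed.

Lemma dubrovnik_skein_plug (E : exterior 2 2) :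
  P (plug E tangle_X) - P (plug E tangle_Xbar) =
  zvar * (P (plug E tangle_0) - P (plug E tangle_oo)).
Proof. by apply: (dubrovnik_skein hP (E := E)); apply: rst_refl. Qed.

Definition cup : tangle 0 2 := @Tangle 0 2 [:: (Cup, 0%N)] isT.
Definition cap : tangle 2 0 := @Tangle 2 0 [:: (Cap, 0%N)] isT.

(* Reversing one of the two strands changes the sign of the crossing: [X]
   closed by [cap] is a negative curl, although [curl _ true] is positive. *)
Lemma dubrovnik_X_cap (E : exterior 2 0) :
  P (plug E (comp tangle_X cap)) = avar^-1 * P (plug E cap).
Proof.
pose kink : tangle 2 2 := pad 0 1 (curl false false).
have -> : P (plug E (comp tangle_X cap)) = P (plug E (comp kink cap)).
  (* Insert a zigzag on the upper strand, exchange its cup with the crossing, slide its cap through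
     the crossing (which flips the boolean), then exchange the two caps. *)
  pose T1 := @Tangle 2 0
    [:: (Cross true, 0); (Cup, 0); (Cap, 1); (Cap, 0)]%N isT.
  pose T2 := @Tangle 2 0
    [:: (Cup, 0); (Cross true, 2); (Cap, 1); (Cap, 0)]%N isT.
  pose T3 := @Tangle 2 0
    [:: (Cup, 0); (Cross false, 1); (Cap, 2); (Cap, 0)]%N isT.
  transitivity (P (plug E T1)).
    symmetry; apply: (dubrovnik_move (u := [:: (Cross true, 0%N)])
      (v := [:: (Cap, 0%N)]) E (or_introl (pm_zigzag_down 0))); by [].
  transitivity (P (plug E T2)).
    symmetry; apply: (dubrovnik_move (u := [::])
      (v := [:: (Cap, 1); (Cap, 0)]%N) E
      (or_introl (@pm_exchange Cup (Cross true) 0 2 isT))); by [].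
  transitivity (P (plug E T3)).
    symmetry; apply: (dubrovnik_move (u := [:: (Cup, 0%N)])
      (v := [:: (Cap, 0%N)]) E (or_introl (pm_cap_slide false 1))); by [].
  symmetry; apply: (dubrovnik_move (u := [:: (Cup, 0); (Cross false, 1)]%N)
    (v := [::]) E (or_introl (@pm_exchange Cap Cap 0 0 isT))); by [].
pose E1 : exterior 1 1 := @absorb_pad 0 1 1 1 (absorb_right E cap).
apply: (dubrovnik_curl_neg hP (E := E1) (side := false)); rewrite /fills.
- by rewrite plug_absorb_pad plug_absorb_right; apply: rst_refl.
- rewrite plug_absorb_pad plug_absorb_right.
  have -> : comp (pad 0 1 (trivial_tangle 1)) cap = cap by apply: val_inj.
  exact: rst_refl.
Qed.

(** The crossing next to [cap] is removed first, with the rest of the row absorbed into the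
    exterior. *)
Lemma dubrovnik_row_cap m (E : exterior 2 0) :
  P (plug E (comp (row_X m) cap)) = avar^-1 ^+ m * P (plug E cap).
Proof.
elim: m => [|m IH].
  by rewrite expr0 mul1r; congr (P (plug E _)); apply: val_inj.
by rewrite -compA -plug_absorb_left dubrovnik_X_cap plug_absorb_left IH
  mulrA exprS.
Qed.

Lemma dubrovnik_row_oo m (E : exterior 2 2) :
  P (plug E (comp (row_X m) tangle_oo)) =
  avar^-1 ^+ m * P (plug E tangle_oo).
Proof.
(* No strand joins the two arcs, so the right one can go into the exterior. *)
have -> : tangle_oo = comp cap cup by apply: val_inj.
by rewrite compA -!(plug_absorb_right E _ cup) dubrovnik_row_cap.
Qed.

Lemma dubrovnik_row_recurrence m (E : exterior 2 2) :
  P (plug E (row_X m.+2)) = P (plug E (row_X m)) +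
    zvar * (P (plug E (row_X m.+1)) - avar^-1 ^+ m.+1 * P (plug E tangle_oo)).
Proof.
have /eqP := dubrovnik_skein_plug (absorb_left E (row_X m.+1)).
rewrite !plug_absorb_left dubrovnik_row_oo subr_eq addrC => /eqP ->.
congr (_ + _ * (P (plug E _) - _)); last first.
  by apply: val_inj; rewrite /= cats0.
(* The switched crossing cancels the last [X] of [row_X m.+1]. *)
apply: (dubrovnik_move (u := row_X m) (v := [::]) E
  (or_intror (rm_II true 0))); by rewrite /= ?cats0 -?catA.
Qed.

End Dubrovnik.

(** For i > m/2 one has m - i < i, so the added binomials vanish. This frees the sums from the
    parity of m. *)
Lemma B_coef_widen m n : (m %/ 2 < n)%N ->
  B_coef m = \sum_(0 <= i < n) zvar ^+ (m - 2 * i) * ('C(m - i, i))%:R.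
Proof.
move=> hn; rewrite /B_coef (big_cat_nat (n := (m %/ 2).+1) (p := n)) //=.
rewrite [X in _ = _ + X]big_nat_cond [X in _ = _ + X]big1 ?addr0 // => i hi.
by rewrite bin_small ?mulr0 //; lia.
Qed.

Lemma B_coef0 : B_coef 0 = 1.
Proof. by rewrite /B_coef big_nat1 expr0 mul1r. Qed.

Lemma B_coef1 : B_coef 1 = zvar.
Proof. by rewrite /B_coef big_nat1 muln0 subn0 expr1 bin0 mulr1. Qed.

Lemma B_coef_recurrence m : B_coef m.+2 = zvar * B_coef m.+1 + B_coef m.
Proof.
rewrite (@B_coef_widen m.+2 m.+2) 1?(@B_coef_widen m.+1 m.+2)
  1?(@B_coef_widen m m.+1); try lia.
rewrite big_nat_recl // [in RHS]big_nat_recl // mulrDr !muln0 !subn0 !bin0.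
rewrite !mulr1 -exprS -addrA; congr (_ + _).
rewrite mulr_sumr -big_split /=; apply: eq_big_nat => i hi.
have -> : (m.+2 - i.+1 = (m - i).+1)%N by lia.
have -> : (m.+2 - 2 * i.+1 = m - 2 * i)%N by lia.
rewrite binS natrD mulrDr subSS; congr (_ + _).
(* When m <= 2i the exponent subtraction truncates, but the binomial of m - i over i + 1 is then
   zero. *)
have [him | him] := leqP (2 * i).+1 m; last first.
  by rewrite bin_small ?mulr0 //; lia.
have -> : (m - 2 * i = (m.+1 - 2 * i.+1).+1)%N by lia.
by rewrite exprS mulrA.
Qed.

(** After shifting j by one, the inner sum is z B_j times a nonpositive power of a. *)
Lemma C_coefE m :
  C_coef m = \sum_(0 <= j < m) zvar * B_coef j * avar^-1 ^+ (m - j.+1).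
Proof.
rewrite /C_coef big_add1; apply: eq_big_nat => j /andP[_ hj].
rewrite /B_coef mulr_sumr mulr_suml subn1 /=.
apply: eq_big_nat => i hi.
have -> : (j.+1 - 2 * i = (j - 2 * i).+1)%N by lia.
have -> : j.+1%:Z - m%:Z = - (m - j.+1)%N%:Z by lia.
by rewrite -exprz_inv exprS -!mulrA; do 2 congr (_ * _); rewrite mulrC.
Qed.

Lemma C_coef0 : C_coef 0 = 0.
Proof. by rewrite C_coefE big_nil. Qed.

Lemma C_coefS m : C_coef m.+1 = avar^-1 * C_coef m + zvar * B_coef m.
Proof.
rewrite !C_coefE big_nat_recr //= subnn expr0 mulr1; congr (_ + _).
rewrite mulr_sumr; apply: eq_big_nat => j /andP[_ hj].
by rewrite mulrCA -exprS -subSn.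
Qed.

Lemma C_coef1 : C_coef 1 = zvar.
Proof. by rewrite C_coefS C_coef0 B_coef0 mulr0 add0r mulr1. Qed.

(** The power of a^-1 is added here because [C_coef] enters the formula with a minus sign. *)
Lemma C_coef_recurrence m :
  C_coef m.+2 = C_coef m + zvar * (C_coef m.+1 + avar^-1 ^+ m.+1).
Proof.
elim: m => [|m IH].
  rewrite C_coefS C_coef1 C_coef0 B_coef1 expr1.
  by move: zvar avar^-1 => z b; ring.
rewrite C_coefS {1}IH B_coef_recurrence (C_coefS m.+1) (exprS _ m.+1).
rewrite (C_coefS m).
move: (C_coef m) (B_coef m) (B_coef m.+1) zvar avar^-1 (avar^-1 ^+ m.+1).
by move=> c b0 b1 z b bm; ring.
Qed.

(** The separate value at 1 agrees with B_0 = 1. *)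
Lemma A_coefS m : A_coef m.+1 = B_coef m.
Proof. by case: m => [|m]; rewrite /A_coef ?B_coef0 // subn1. Qed.

Theorem theorem2 (P : diagram -> ratfun) (hP : dubrovnik P)
    (m : nat) (hm : (0 < m)%N)
    (E : exterior 2 2) (L0 Lminus Loo Lm : diagram)
    (hL0 : fills E tangle_0 L0)
    (hLminus : fills E tangle_Xbar Lminus)
    (hLoo : fills E tangle_oo Loo)
    (hLm : fills E (row_X m) Lm) :
  P Lm = A_coef m * P Lminus + B_coef m * P L0 - C_coef m * P Loo.
Proof.
rewrite (dubrovnik_fills hP hL0) (dubrovnik_fills hP hLminus).
rewrite (dubrovnik_fills hP hLoo) (dubrovnik_fills hP hLm).
case: m hm {hLm} => // m _; rewrite A_coefS.
pose p k := P (plug E (row_X k)).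
pose formula k := p k.+1 = B_coef k * P (plug E tangle_Xbar)
  + B_coef k.+1 * P (plug E tangle_0) - C_coef k.+1 * P (plug E tangle_oo).
have formula0 : formula 0%N.
  have /eqP := dubrovnik_skein_plug hP E.
  have -> : tangle_X = row_X 1 by apply: val_inj.
  rewrite /formula /p subr_eq B_coef0 B_coef1 C_coef1 => /eqP ->.
  by rewrite mul1r mulrBr addrC addrA.
(* The recurrence has order two, so two consecutive cases are carried. *)
suff [] : formula m /\ formula m.+1 by [].
elim: m => [|m [IH0 IH1]]; split=> //; rewrite /formula.
(* Here the recurrence reaches [row_X 0], which is [tangle_0] itself. *)
- rewrite {1}/p (dubrovnik_row_recurrence hP) -/(p 1%N) formula0.
  rewrite B_coef_recurrence C_coef_recurrence C_coef0 B_coef0 /=.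
  rewrite B_coef1 C_coef1.
  move: (P _) (P _) (P _) zvar avar^-1 => x y t z b; ring.
- rewrite {1}/p (dubrovnik_row_recurrence hP) -/(p m.+1) -/(p m.+2) IH0 IH1.
  rewrite (B_coef_recurrence m.+1) (C_coef_recurrence m.+1).
  rewrite (B_coef_recurrence m).
  move: (P _) (P _) (P _) (B_coef m) (B_coef m.+1) (C_coef m.+1) (C_coef m.+2).
  move: zvar (avar^-1 ^+ m.+2) => z b *; ring.
Qed.
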